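(* Let $0<q<1$ and suppose $$f(\mu;x)={}_2\phi_1(0,0;q^\mu;x)=\sum_{n=0}^\infty\frac{x^n}{(q^\mu;q)_n(q;q)_n}.$$ Then the power series coefficients (in powers of $x$) of the generalized Turánian $$\Delta_f(\alpha,\beta;x)=f(\mu+\alpha;x)f(\mu+\beta;x)-f(\mu;x)f(\mu+\alpha+\beta;x)$$ are negative for all $\mu,\alpha,\beta>0$. In particular, $\mu\mapsto f(\mu;x)$ is log-convex on $[0,\infty)$ for $0<x<1$.
   Context: The $q$-shifted factorial is $(a;q)_0=1$, $(a;q)_n=\prod_{k=0}^{n-1}(1-aq^k)$ for $n\in\mathbb{N}$. The function ${}_2\phi_1(0,0;q^\mu;x)$ is Heine's basic hypergeometric series with base $q$, both upper parameters equal to $0$ and lower parameter $q^\mu$, given by the displayed series, which converges for $|x|<1$.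
   Formalization: The constant coefficient of the Turánian is always 0, so negativity is stated for the coefficients of x^n with n ≥ 1; at μ = 0 the series has zero denominators, so f(0;x) is taken to be +∞ in the log-convexity claim on [0,∞). *)

(* Defs.v *)
From mathcomp Require Import all_boot all_order all_algebra.
From mathcomp Require Import all_classical all_reals all_analysis.
From mathcomp Require Import ring lra.

Set Implicit Arguments.
Unset Strict Implicit.
Unset Printing Implicit Defensive.

Import Order.TTheory GRing.Theory Num.Theory.
Import numFieldNormedType.Exports.

Local Open Scope classical_set_scope.
Local Open Scope ring_scope.

Definition qpochhammer (R : realType) (a q : R) (n : nat) : R :=
  \prod_(k < n) (1 - a * q ^+ k).

Definition heine_coef (R : realType) (a b c q : R) (n : nat) : R :=
  (qpochhammer a q n * qpochhammer b q n)
  / (qpochhammer c q n * qpochhammer q q n).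

Definition heine2phi1 (R : realType) (a b c q x : R) : R :=
  limn (pseries (heine_coef a b c q) x).

(* Meaningful for mu > 0 only: at mu = 0 the denominators vanish. *)
Definition phi (R : realType) (q mu x : R) : R := heine2phi1 0 0 (q `^ mu) q x.

(* The same series summed in the extended reals, where 0^-1 = +oo. For
   0 <= x < 1 it agrees with [phi] when mu > 0 ([ephiE]); at mu = 0, where
   (q^mu; q)_n = 0 for all n > 0, it takes the value +oo for x > 0 ([ephi0]). *)
Definition ephi (R : realType) (q mu x : R) : \bar R :=
  (\sum_(0 <= n <oo)
     (x ^+ n)%:E / (qpochhammer (q `^ mu) q n * qpochhammer q q n)%:E)%E.

Definition turanian (R : realType) (f : R -> R -> R) (mu alpha beta x : R) : R :=
  f (mu + alpha) x * f (mu + beta) x - f mu x * f (mu + alpha + beta) x.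

Definition has_power_series (R : realType) (c : nat -> R) (r : R)
    (F : R -> R) : Prop :=
  forall x : R, `|x| < r -> pseries c x @ \oo --> F x.

(* Positivity excludes the value -oo of [lne], hence sums of opposite
   infinities; note that 0 * +oo = 0 when t is 0 or 1. *)
Definition log_convex_on (R : realType) (D : set R) (g : R -> \bar R) : Prop :=
  (forall a, D a -> (0 < g a)%E) /\
  forall a b t : R, D a -> D b -> 0 <= t <= 1 ->
    (lne (g (t * a + (1 - t) * b)%R)
       <= t%:E * lne (g a) + (1 - t)%:E * lne (g b))%E.

Section Facts.
Variable R : realType.
Implicit Types q mu x c : R.

Lemma qpochhammer0l q n : qpochhammer 0 q n = 1.
Proof. by rewrite /qpochhammer big1// => i _; rewrite mul0r subr0. Qed.

Lemma qpochhammerS (a q : R) n :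
  qpochhammer a q n.+1 = qpochhammer a q n * (1 - a * q ^+ n).
Proof. by rewrite /qpochhammer big_ord_recr. Qed.

Lemma phiE q mu x :
  phi q mu x =
  limn (series (fun n =>
    x ^+ n / (qpochhammer (q `^ mu) q n * qpochhammer q q n))).
Proof.
rewrite /phi /heine2phi1 /pseries; congr (limn (series _)).
apply/funext => n /=.
by rewrite /heine_coef !qpochhammer0l mulr1 mul1r mulrC.
Qed.

Lemma qpochhammer_gt0 (a q : R) n :
  0 < q < 1 -> 0 <= a < 1 -> 0 < qpochhammer a q n.
Proof.
move=> /andP[q0 q1] /andP[a0 a1].
apply: prodr_gt0 => i _; rewrite subr_gt0.
apply: le_lt_trans a1; rewrite ler_piMr// exprn_ile1 ?ltW//.
Qed.

Lemma powR_in01 q mu : 0 < q < 1 -> 0 < mu -> 0 <= q `^ mu < 1.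
Proof.
move=> /andP[q0 q1] mu0; rewrite powR_ge0/=.
have -> : (1 : R) = 1 `^ mu by rewrite powR1.
by apply: gt0_ltr_powR; rewrite // ?nnegrE ?ltW.
Qed.

Lemma is_cvg_heine_ge0 q c x : 0 < q < 1 -> 0 <= c < 1 -> 0 < x < 1 ->
  cvgn (series (fun n => x ^+ n / (qpochhammer c q n * qpochhammer q q n))).
Proof.
move=> q01 c01 /andP[x0 x1].
have /andP[q0 q1] := q01; have /andP[c0 c1] := c01.
have q01' : 0 <= q < 1 by rewrite ltW.
set t := fun n => _.
have t0 n : 0 < t n.
  by rewrite divr_gt0 ?exprn_gt0// mulr_gt0// qpochhammer_gt0.
have [r [r0 r1 xr]] : exists r : R, [/\ 0 < r, r < 1 & x < r].
  by exists ((x + 1) / 2); split; lra.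
have [N HN] : exists N, forall n, (N <= n)%N -> t n.+1 <= r * t n.
  have e0 : 0 < (r - x) / (2 * r) by rewrite divr_gt0 ?subr_gt0// mulr_gt0.
  have /cvgrPdist_lt/(_ _ e0) [N _ HN] : (fun n => q ^+ n) @ \oo --> (0 : R).
    by apply: cvg_expr; rewrite gtr0_norm.
  exists N => n Nn; have := HN n Nn.
  rewrite /= sub0r normrN gtr0_norm ?exprn_gt0// ltr_pdivlMr ?mulr_gt0// => Hq.
  have Q0 : 0 < q ^+ n by rewrite exprn_gt0.
  have cQ : c * q ^+ n <= q ^+ n by rewrite ler_piMl// ltW.
  have qQ : q * q ^+ n <= q ^+ n by rewrite ler_piMl// ltW.
  have cQ0 : 0 <= c * q ^+ n by rewrite mulr_ge0// ltW.
  have qQ0 : 0 <= q * q ^+ n by rewrite mulr_ge0// ltW.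
  have Hle : x <= r * ((1 - c * q ^+ n) * (1 - q * q ^+ n)).
    apply: (@le_trans _ _ (r * (1 - 2 * q ^+ n))); first by nra.
    by rewrite ler_pM2l//; nra.
  have P0 : 0 < (1 - c * q ^+ n) * (1 - q * q ^+ n) by nra.
  have -> : t n.+1 = t n * (x / ((1 - c * q ^+ n) * (1 - q * q ^+ n))).
    rewrite /t !qpochhammerS exprS [in RHS]mulrACA -invfM; congr (_ / _).
      by rewrite mulrC.
    by rewrite mulrACA.
  by rewrite mulrC ler_pM2r// ler_pdivrMr.
pose u n := t n / r ^+ n.
have u0 n : 0 <= u n by rewrite divr_ge0 ?exprn_ge0// ltW.
pose K := \sum_(i < N.+1) u i.
have uK n : (n <= N)%N -> u n <= K.
  rewrite -ltnS => nN; rewrite /K (bigD1 (Ordinal nN))//= lerDl sumr_ge0//.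
have uK' n : u n <= K.
  elim: n => [|n IH]; first exact: uK.
  have [|Nn] := leqP n.+1 N; first exact: uK.
  apply: le_trans IH; rewrite /u ler_pdivrMr ?exprn_gt0// exprS mulrCA.
  by rewrite divfK ?expf_neq0 ?gt_eqF//; exact: HN.
apply: (@series_le_cvg _ _ (geometric K r)) => [n|n|n|].
- exact: ltW.
- by apply: geometric_ge0; [exact: le_trans (u0 0%N) (uK' 0%N)|exact: ltW].
- by rewrite /geometric/= -ler_pdivrMr ?exprn_gt0//; exact: uK'.
- by apply: is_cvg_geometric_series; rewrite gtr0_norm.
Qed.

Lemma is_cvg_heine q c x : 0 < q < 1 -> 0 <= c < 1 -> `|x| < 1 ->
  cvgn (pseries (heine_coef 0 0 c q) x).
Proof.
move=> q01 c01 x1.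
have x0 := normr_ge0 x.
have [z [xz z01]] : exists z : R, `|x| < z /\ 0 < z < 1.
  by exists ((`|x| + 1) / 2); split; lra.
apply: (@is_cvg_pseries_inside _ _ z); last first.
  by rewrite [`|z|]gtr0_norm//; case/andP: z01.
rewrite /pseries (_ : (fun _ => _) = fun n =>
    z ^+ n / (qpochhammer c q n * qpochhammer q q n)).
  exact: is_cvg_heine_ge0.
by apply/funext => n; rewrite /heine_coef !qpochhammer0l mulr1 mul1r mulrC.
Qed.

Lemma ephiE q mu x : 0 < q < 1 -> 0 < mu -> 0 <= x < 1 ->
  ephi q mu x = (phi q mu x)%:E.
Proof.
move=> q01 mu0 /andP[x0 x1].
have c01 := powR_in01 q01 mu0.
have q01' : 0 <= q < 1 by case/andP: q01 => ? ?; rewrite ltW.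
have := @is_cvg_heine q _ x q01 c01; rewrite ger0_norm// => /(_ x1) cv.
rewrite /phi /heine2phi1 -EFin_lim//; congr (limn _).
apply/funext => n /=; rewrite /pseries /series /= -sumEFin.
apply: eq_bigr => i _.
rewrite inver gt_eqF ?mulr_gt0 ?qpochhammer_gt0// -EFinM.
by rewrite /heine_coef !qpochhammer0l mulr1 mul1r mulrC.
Qed.

Lemma ephi0 q x : 0 < q < 1 -> 0 < x -> ephi q 0 x = +oo%E.
Proof.
move=> q01 x0; rewrite /ephi powRr0.
have P0 n : qpochhammer 1 q n.+1 = 0.
  by rewrite /qpochhammer big_ord_recl expr0 mulr1 subrr mul0r.
have T0 n : (0 <= (x ^+ n)%:E / (qpochhammer 1 q n * qpochhammer q q n)%:E)%E.
  apply: mule_ge0; first by rewrite lee_fin exprn_ge0 ?ltW.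
  rewrite inve_ge0 lee_fin.
  case: n => [|n]; last by rewrite P0 mul0r.
  by rewrite /qpochhammer !big_ord0 mulr1.
apply/eqP; rewrite -leye_eq.
apply: le_trans (nneseries_lim_ge 2%N _) => //.
rewrite big_nat_recr//= [X in (_ + X)%E](_ : _ = +oo%E).
  by rewrite addey// gt_eqF// (lt_le_trans ltNy0)// sume_ge0.
by rewrite P0// mul0r inve0 gt0_muley// lte_fin exprn_gt0.
Qed.

End Facts.

(* Main.v *)
(** Write c = q^mu, A = q^alpha, B = q^beta and g_k(a) = 1/(a;q)_k. Grouping the
k-th and (n-k)-th summands of the n-th coefficient of the Turanian gives
nonnegative weights times
  g_k(cA) g_m(cB) + g_m(cA) g_k(cB) - g_k(c) g_m(cAB) - g_m(c) g_k(cAB),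
where m = n - k. For k <= m one has g_m(a) = g_k(a) h(a), with
h(a) = g_{m-k}(a q^k), and the difference is nonpositive because
  g_k(cA) g_k(cB) <= g_k(c) g_k(cAB)  and  h(cA) + h(cB) <= h(c) + h(cAB).
The first inequality is (1-cA)(1-cB) >= (1-c)(1-cAB) applied factor by factor;
the second follows from its analogue for h and from the monotonicity of h. For
k = 0 < n the inequality is strict.

Log-convexity with arbitrary weights is not deduced from the midpoint case: the
weighted AM-GM inequality shows that each term of the series is log-convex in
mu, and, as in the proof of Hoelder's inequality, so is their sum. At mu = 0 the
right-hand side of the inequality is infinite. *)

Require Import Defs.
From mathcomp Require Import all_boot all_order all_algebra.
From mathcomp Require Import all_classical all_reals all_analysis.
From mathcomp Require Import zify ring lra.

Import Order.TTheory GRing.Theory Num.Theory.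
Import numFieldNormedType.Exports.

Local Open Scope classical_set_scope.
Local Open Scope ring_scope.

(** * Cauchy products of absolutely convergent series *)

Section CauchyProduct.
Variable R : realType.
Implicit Types u v : nat -> R.

Definition cauchy_product u v : nat -> R :=
  fun n => \sum_(k < n.+1) u k * v (n - k)%N.

(** Both sides sum [u k * v j] over the triangle [k + j < n]: by antidiagonals on the left, by rows
    on the right. *)
Lemma series_cauchy_product u v n :
  series (cauchy_product u v) n = \sum_(k < n) u k * series v (n - k)%N.
Proof.
elim: n => [|n IH]; first by rewrite /series/= big_geq// big_ord0.
rewrite seriesSr IH [RHS]big_ord_recr/= /cauchy_product.
rewrite big_ord_recr/= addrA -big_split/=; congr (_ + _).
  apply: eq_bigr => k _; rewrite -mulrDr subSn; last exact: ltnW.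
  by rewrite seriesSr.
by rewrite subSn// subnn seriesSr /series/= big_geq// add0r.
Qed.

Let seriesM u v m n :
  series u m * series v n = \sum_(k < m) u k * series v n.
Proof. by rewrite {1}/series/= big_mkord mulr_suml. Qed.

Lemma ger0_nondecreasing_series u : (forall n, 0 <= u n) ->
  {homo series u : m n / (m <= n)%N >-> m <= n}.
Proof. by move=> u0; apply: nondecreasing_series => n _ _; exact: u0. Qed.

Lemma half_cvgny : (fun n => n./2) @ \oo --> \oo.
Proof.
apply/cvgnyPge => A; exists A.*2 => // n /= An.
by rewrite -(doubleK A); exact: half_leq.
Qed.

(* U_(n/2) V_(n/2) <= C_n <= U_n V_n for the partial sums. *)
Lemma ger0_series_cauchy_product_cvg u v :
  (forall n, 0 <= u n) -> (forall n, 0 <= v n) ->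
  cvgn (series u) -> cvgn (series v) ->
  series (cauchy_product u v) @ \oo --> limn (series u) * limn (series v).
Proof.
move=> u0 v0 cu cv.
have uvcvg : (fun n => series u n * series v n) @ \oo -->
    limn (series u) * limn (series v) by exact: cvgM.
have uvcvg2 : (fun n => series u n./2 * series v n./2) @ \oo -->
    limn (series u) * limn (series v) := cvg_comp _ _ half_cvgny uvcvg.
apply: (squeeze_cvgr _ uvcvg2 uvcvg); near=> n.
rewrite series_cauchy_product.
have vS0 m : 0 <= series v m by exact: sumr_ge0.
rewrite !seriesM; apply/andP; split.
  (* For [k < n./2] one has [n./2 <= n - k], so these rows of the triangle contain those of the
     square; the remaining rows are nonnegative. *)
  have hn : (n./2 <= n)%N by have := odd_double_half n; lia.
  rewrite -(big_mkord xpredT (fun k => u k * series v n./2)).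
  rewrite -(big_mkord xpredT (fun k => u k * series v (n - k)%N)).
  rewrite [leRHS](big_cat_nat _ hn)//= -[leLHS]addr0 lerD//.
    rewrite !big_mkord; apply: ler_sum => k _; rewrite ler_wpM2l//.
    apply: ger0_nondecreasing_series => //.
    have := ltn_ord k; have := odd_double_half n; lia.
  by apply: sumr_ge0 => k _; exact: mulr_ge0.
apply: ler_sum => k _; rewrite ler_wpM2l//.
by apply: ger0_nondecreasing_series => //; exact: leq_subr.
Unshelve. all: by end_near. Qed.

Lemma series_cauchy_product_cvg u v :
  cvgn [normed series u] -> cvgn [normed series v] ->
  series (cauchy_product u v) @ \oo --> limn (series u) * limn (series v).
Proof.
move=> nu nv.
have cu := normed_cvg nu; have cv := normed_cvg nv.
have uvcvg : (fun n => series u n * series v n) @ \oo -->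
    limn (series u) * limn (series v) by exact: cvgM.
pose U n := `|u n|; pose V n := `|v n|.
have UVcvg : (fun n => series U n * series V n) @ \oo -->
    limn (series U) * limn (series V) by exact: cvgM.
have UVC := @ger0_series_cauchy_product_cvg U V (fun=> normr_ge0 _)
  (fun=> normr_ge0 _) nu nv.
(* The error is dominated by that for the series of absolute values. *)
have D0 : (fun n => series u n * series v n - series (cauchy_product u v) n)
    @ \oo --> (0 : R).
  have UV0 : (fun n => series U n * series V n - series (cauchy_product U V) n)
      @ \oo --> (0 : R).
    by rewrite -(subrr (limn (series U) * limn (series V))); exact: cvgB.
  apply: norm_cvg0; apply: (squeeze_cvgr _ (cvg_cst (0 : R)) UV0).
  near=> n; rewrite normr_ge0/= !series_cauchy_product.
  rewrite !seriesM -!sumrB.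
  apply: le_trans (ler_norm_sum _ _ _) _; apply: ler_sum => k _.
  rewrite -!mulrBr normrM ler_wpM2l//.
  have kn : (n - k <= n)%N by exact: leq_subr.
  by rewrite !sub_series_geq// ler_norm_sum.
rewrite -[X in _ --> X]subr0 (_ : series _ = fun n => series u n * series v n -
    (series u n * series v n - series (cauchy_product u v) n)).
  exact: cvgB.
by apply/funext => n; rewrite subKr.
Unshelve. all: by end_near. Qed.

End CauchyProduct.

(** * Inequalities for q-shifted factorials and the sign of the Turanian coefficients *)

Section QPochhammer.
Variables (R : realType) (q : R).
Hypothesis q01 : 0 < q < 1.

Let qn_gt0 n : 0 < q ^+ n. Proof. by case/andP: q01 => ? _; rewrite exprn_gt0. Qed.
Let qn_le1 n : q ^+ n <= 1.
Proof. by case/andP: q01 => ? ?; rewrite exprn_ile1// ltW. Qed.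

Lemma qpochhammerD (a : R) m n :
  qpochhammer a q (m + n) = qpochhammer a q m * qpochhammer (a * q ^+ m) q n.
Proof.
rewrite /qpochhammer big_split_ord/=; congr (_ * _).
by apply: eq_bigr => i _; rewrite exprD mulrA.
Qed.

Lemma le_qpochhammer (a b : R) n : a <= b -> b < 1 ->
  0 <= b -> qpochhammer b q n <= qpochhammer a q n.
Proof.
move=> ab b1 b0; apply: ler_prod => i _.
have := qn_gt0 i; have := qn_le1 i => qi1 qi0.
by apply/andP; split; nra.
Qed.

Lemma lt_qpochhammer (a b : R) n : (0 < n)%N -> a < b -> b < 1 ->
  0 <= b -> qpochhammer b q n < qpochhammer a q n.
Proof.
move=> n0 ab b1 b0; apply: ltr_prod.
  by apply/hasP; exists (Ordinal n0); rewrite ?mem_index_enum.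
move=> i _; have := qn_gt0 i; have := qn_le1 i => qi1 qi0.
by apply/andP; split; nra.
Qed.

(** With [Q = q ^+ i], the [i]-th factor on the right exceeds the one on the left by
    [c * Q * ((1 - A) * (1 - B))]. *)
Lemma qpochhammerM_scale_le (c A B : R) n :
  0 < c < 1 -> 0 < A < 1 -> 0 < B < 1 ->
  qpochhammer c q n * qpochhammer (c * A * B) q n <=
  qpochhammer (c * A) q n * qpochhammer (c * B) q n.
Proof.
move=> /andP[c0 c1] /andP[A0 A1] /andP[B0 B1].
rewrite /qpochhammer -!big_split/=; apply: ler_prod => i _.
have := qn_gt0 i; have := qn_le1 i; set Q := q ^+ i => Q1 Q0.
have cQ : c * Q <= 1 by nra.
have cQ0 : 0 < c * Q by nra.
have AB1 : A * B <= 1 by nra.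
have AB0 : 0 < A * B by nra.
apply/andP; split; first by rewrite mulr_ge0//; nra.
rewrite -subr_ge0 [leRHS](_ : _ = c * Q * ((1 - A) * (1 - B))); last by ring.
by rewrite mulr_ge0 ?ltW// mulr_gt0// subr_gt0.
Qed.

Let g (c : R) n := (qpochhammer c q n)^-1.

Let scale_in01 {c A : R} : 0 < c < 1 -> 0 < A < 1 -> 0 < c * A < 1.
Proof. by move=> /andP[? ?] /andP[? ?]; rewrite mulr_gt0//= mulr_ilt1 ?ltW. Qed.

Let qP_gt0 c n : 0 < c < 1 -> 0 < qpochhammer c q n.
Proof. by move=> /andP[? ?]; rewrite qpochhammer_gt0// ltW. Qed.

Let g_gt0 c n : 0 < c < 1 -> 0 < g c n.
Proof. by move=> c01; rewrite invr_gt0 qP_gt0. Qed.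

Let gD c m n : g c (m + n) = g c m * g (c * q ^+ m) n.
Proof. by rewrite /g qpochhammerD invfM. Qed.

Let gM {c A B : R} n : 0 < c < 1 -> 0 < A < 1 -> 0 < B < 1 ->
  g (c * A) n * g (c * B) n <= g c n * g (c * A * B) n.
Proof.
move=> c01 A01 B01; have cA01 := scale_in01 c01 A01.
have cB01 := scale_in01 c01 B01; have cAB01 := scale_in01 cA01 B01.
rewrite /g -!invfM lef_pV2 ?posrE ?mulr_gt0 ?qP_gt0//.
exact: qpochhammerM_scale_le.
Qed.

Let g_le c A n : 0 < c < 1 -> 0 < A < 1 -> g (c * A) n <= g c n.
Proof.
move=> c01 A01; have cA01 := scale_in01 c01 A01.
rewrite /g lef_pV2 ?posrE ?qP_gt0//.
by case/andP: c01 A01 => ? ? /andP[? ?]; apply: le_qpochhammer => //; nra.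
Qed.

Let g_lt c A n : (0 < n)%N -> 0 < c < 1 -> 0 < A < 1 -> g (c * A) n < g c n.
Proof.
move=> n0 c01 A01; have cA01 := scale_in01 c01 A01.
rewrite /g ltf_pV2 ?posrE ?qP_gt0//.
by case/andP: c01 A01 => ? ? /andP[? ?]; apply: lt_qpochhammer => //; nra.
Qed.

(* With x = g c n, y = g (c * A) n, z = g (c * B) n and w = g (c * A * B) n:
   x (x + w - y - z) >= (x - y) (x - z) >= 0, since y z <= x w. *)
Let gDD {c A B : R} n : 0 < c < 1 -> 0 < A < 1 -> 0 < B < 1 ->
  g (c * A) n + g (c * B) n <= g c n + g (c * A * B) n.
Proof.
move=> c01 A01 B01; have h := gM n c01 A01 B01.
have hA := g_le c A n c01 A01; have hB := g_le c B n c01 B01.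
rewrite -(ler_pM2l (g_gt0 c n c01)); nra.
Qed.

(** For [0 < n] both [x - y] and [x - z] in the argument for [gDD] are positive, hence so is their
    product. *)
Let gDD_lt {c A B : R} n : (0 < n)%N -> 0 < c < 1 -> 0 < A < 1 -> 0 < B < 1 ->
  g (c * A) n + g (c * B) n < g c n + g (c * A * B) n.
Proof.
move=> n0 c01 A01 B01; have h := gM n c01 A01 B01.
have hA := g_lt c A n n0 c01 A01; have hB := g_lt c B n n0 c01 B01.
rewrite -(ltr_pM2l (g_gt0 c n c01)); nra.
Qed.

Let pair_le {c A B : R} k m : 0 < c < 1 -> 0 < A < 1 -> 0 < B < 1 ->
  g (c * A) k * g (c * B) m + g (c * A) m * g (c * B) k <=
  g c k * g (c * A * B) m + g c m * g (c * A * B) k.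
Proof.
move=> c01 A01 B01; wlog km : k m / (k <= m)%N => [H|].
  by have [/H//|/ltnW/H] := leqP k m; rewrite addrC [leRHS]addrC.
rewrite -(subnKC km) !gD; move: (m - k)%N => d.
have Q01 : 0 < c * q ^+ k < 1.
  case/andP: c01 => c0 c1; rewrite mulr_gt0//=.
  by rewrite (le_lt_trans _ c1)// ler_piMr// ltW.
have h1 := gM k c01 A01 B01; have h2 := gDD d Q01 A01 B01.
rewrite !(mulrAC _ _ (q ^+ k)).
have cA01 := scale_in01 c01 A01; have cB01 := scale_in01 c01 B01.
have QA01 := scale_in01 Q01 A01; have QB01 := scale_in01 Q01 B01.
have hA := g_gt0 _ d QA01; have hB := g_gt0 _ d QB01.
have gA := g_gt0 _ k cA01; have gB := g_gt0 _ k cB01.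
set X := g (c * A) k in h1 gA *; set Y := g (c * B) k in h1 gB *.
set Z := g c k in h1 *; set W := g (c * A * B) k in h1 *.
(* Factoring out the parts of length [k] leaves two products, compared by [gM] at [c] and by [gDD]
   at [c * q ^+ k]. *)
rewrite [leLHS](_ : _ =
  X * Y * (g (c * q ^+ k * A) d + g (c * q ^+ k * B) d)); last by ring.
rewrite [leRHS](_ : _ =
  Z * W * (g (c * q ^+ k) d + g (c * q ^+ k * A * B) d)); last by ring.
by apply: ler_pM => //; rewrite ltW// ?mulr_gt0 ?addr_gt0.
Qed.

Lemma cauchy_product_heine_lt (c A B : R) n :
  0 < c < 1 -> 0 < A < 1 -> 0 < B < 1 -> (0 < n)%N ->
  cauchy_product _ (heine_coef 0 0 (c * A) q) (heine_coef 0 0 (c * B) q) n <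
  cauchy_product _ (heine_coef 0 0 c q) (heine_coef 0 0 (c * A * B) q) n.
Proof.
move=> c01 A01 B01 n0; pose w n := (qpochhammer q q n)^-1.
have w0 m : 0 < w m by rewrite invr_gt0 qP_gt0.
have heineE a m : heine_coef 0 0 a q m = g a m * w m.
  by rewrite /heine_coef !qpochhammer0l mulr1 mul1r invfM.
(* Reversing the index in one of two copies of the sum pairs [k] with [n - k]; the weight
   [w k * w (n - k)] is unchanged. *)
have symE a b : cauchy_product _ (heine_coef 0 0 a q) (heine_coef 0 0 b q) n *+ 2
    = \sum_(k < n.+1) w k * w (n - k)%N *
        (g a k * g b (n - k)%N + g a (n - k)%N * g b k).
  rewrite mulr2n {2}/cauchy_product (reindex_inj rev_ord_inj)/= -big_split/=.
  apply: eq_bigr => k _; rewrite subSS subKn; last by rewrite -ltnS.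
  by rewrite !heineE; ring.
(* Strictness comes from the summand [k = 0]: there [g _ 0 = 1], and the pair inequality becomes
   [gDD_lt]. *)
rewrite -(ltr_pMn2r (ltn0Sn 1)) !symE !big_ord_recl; apply: ltr_leD.
  rewrite ltr_pM2l ?mulr_gt0// subn0.
  have g0 a : g a 0 = 1 by rewrite /g /qpochhammer big_ord0 invr1.
  rewrite !g0 !mul1r !mulr1 addrC [ltRHS]addrC.
  exact: gDD_lt.
by apply: ler_sum => k _; rewrite ler_pM2l ?mulr_gt0//; exact: pair_le.
Qed.

End QPochhammer.

(** * Log-convexity of the Heine series in [mu > 0], with arbitrary weights *)

Section LogConvexity.
Variable R : realType.

(** This is convexity of [expR] at the points [ln u] and [ln v]. *)
Lemma weighted_amgm (s t u v : R) : 0 <= s -> 0 <= t -> s + t = 1 ->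
  0 < u -> 0 < v -> u `^ s * v `^ t <= s * u + t * v.
Proof.
move=> s0 t0 st u0 v0; have s1 : s <= 1 by lra.
have := convex_expR (Itv01 s0 s1) (ln u) (ln v).
rewrite !convRE /= !lnK ?posrE// /unstable.onem (_ : 1 - s = t); last by lra.
by rewrite expRD /powR !gt_eqF.
Qed.

(** The normalised form for Hoelder's argument: [u] and [v] will be terms of two series with sums
    [a] and [b]. *)
Lemma weighted_amgm_scale (s t u v a b : R) : 0 <= s -> 0 <= t -> s + t = 1 ->
  0 < u -> 0 < v -> 0 < a -> 0 < b ->
  u `^ s * v `^ t <= a `^ s * b `^ t * (s * (u / a) + t * (v / b)).
Proof.
move=> s0 t0 st u0 v0 a0 b0.
have ua := divr_gt0 u0 a0; have vb := divr_gt0 v0 b0.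
have divpowK c d r : 0 < c / d -> 0 < d -> d `^ r * (c / d) `^ r = c `^ r :> R.
  by move=> cd0 d0; rewrite -powRM ?ltW// mulrC divfK ?gt_eqF.
rewrite -(divpowK u a)// -(divpowK v b)// mulrACA ler_pM2l.
  exact: weighted_amgm.
by rewrite mulr_gt0 ?powR_gt0.
Qed.

(** Weighted AM-GM for [a], [b] and for [1 - a], [1 - b] gives two upper bounds that add up to
    [s + t = 1]. *)
Lemma powR_conv_le1 (s t a b : R) : 0 <= s -> 0 <= t -> s + t = 1 ->
  0 < a < 1 -> 0 < b < 1 ->
  (1 - a) `^ s * (1 - b) `^ t <= 1 - a `^ s * b `^ t.
Proof.
move=> s0 t0 st /andP[a0 a1] /andP[b0 b1].
have h1 := weighted_amgm s t a b s0 t0 st a0 b0.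
have [a1' b1'] : 0 < 1 - a /\ 0 < 1 - b by rewrite !subr_gt0.
have := weighted_amgm s t _ _ s0 t0 st a1' b1'; nra.
Qed.

(** [powR_conv_le1] applies to each pair of factors, since the weighted geometric mean of
    [a * q ^+ k] and [b * q ^+ k] is [a]^ s * b [^ t * q ^+ k]. *)
Lemma qpochhammer_log_concave (q s t a b : R) n :
  0 < q < 1 -> 0 <= s -> 0 <= t -> s + t = 1 ->
  0 < a < 1 -> 0 < b < 1 ->
  qpochhammer a q n `^ s * qpochhammer b q n `^ t <=
  qpochhammer (a `^ s * b `^ t) q n.
Proof.
move=> q01 s0 t0 st a01 b01.
have q0 : 0 < q by case/andP: q01.
have qk01 c k : 0 < c < 1 -> 0 < c * q ^+ k < 1.
  case/andP: q01 => _ q1 /andP[c0 c1]; rewrite mulr_gt0 ?exprn_gt0//=.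
  by rewrite (le_lt_trans _ c1)// ler_piMr ?exprn_ile1// ltW.
have P0 c m : 0 < c < 1 -> 0 <= qpochhammer c q m.
  by move=> /andP[c0 c1]; rewrite ltW// qpochhammer_gt0// ltW.
elim: n => [|n IH]; first by rewrite /qpochhammer !big_ord0 !powR1 mulr1.
have f0 c : 0 < c < 1 -> 0 <= 1 - c * q ^+ n.
  by move=> /(qk01 _ n)/andP[_ /ltW]; rewrite subr_ge0.
rewrite !qpochhammerS !powRM ?f0 ?P0// mulrACA ler_pM ?mulr_ge0 ?powR_ge0//.
have := powR_conv_le1 s t _ _ s0 t0 st (qk01 _ n a01) (qk01 _ n b01).
case/andP: a01 b01 => a0 _ /andP[b0 _].
rewrite !powRM ?(ltW a0) ?(ltW b0) ?exprn_ge0 ?(ltW q0)// mulrACA -powRD.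
  by rewrite st powRr1 ?exprn_ge0 ?(ltW q0).
by rewrite st oner_eq0.
Qed.

Definition phi_term (q x mu : R) n : R :=
  x ^+ n / (qpochhammer (q `^ mu) q n * qpochhammer q q n).

Lemma phi_term_gt0 q x mu n : 0 < q < 1 -> 0 < mu -> 0 < x ->
  0 < phi_term q x mu n.
Proof.
move=> q01 mu0 x0; rewrite divr_gt0 ?exprn_gt0// mulr_gt0//.
  by rewrite qpochhammer_gt0// powR_in01.
by rewrite qpochhammer_gt0//; case/andP: q01 => ? ->; rewrite ltW.
Qed.

(** Taking reciprocals reverses [qpochhammer_log_concave]; the factor independent of [mu] passes
    through because [s + t = 1]. *)
Lemma phi_term_log_convex (q x a b s t : R) n : 0 < q < 1 -> 0 < x ->
  0 < a -> 0 < b -> 0 <= s -> 0 <= t -> s + t = 1 ->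
  phi_term q x (s * a + t * b) n <=
  phi_term q x a n `^ s * phi_term q x b n `^ t.
Proof.
move=> q01 x0 a0 b0 s0 t0 st.
have q0 : 0 < q by case/andP: q01.
have c01 c : 0 < c -> 0 < q `^ c < 1.
  by move=> c0; rewrite powR_gt0//=; case/andP: (powR_in01 q01 c0).
have P0 c : 0 < c -> 0 < qpochhammer (q `^ c) q n.
  by move=> /c01/andP[? ?]; rewrite qpochhammer_gt0// ltW.
have W0 : 0 < x ^+ n / qpochhammer q q n.
  rewrite divr_gt0 ?exprn_gt0// qpochhammer_gt0//.
  by case/andP: q01 => ? ->; rewrite ltW.
have termE c : phi_term q x c n =
    (x ^+ n / qpochhammer q q n) * (qpochhammer (q `^ c) q n)^-1.
  by rewrite /phi_term invfM mulrCA mulrC.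
move: (x ^+ n / _) W0 termE => W W0 termE.
have c0 : 0 < s * a + t * b.
  have [s00|s00] := ltP 0 s.
    by rewrite ltr_wpDr ?mulr_gt0// mulr_ge0// ltW.
  have -> : s = 0 by lra.
  have -> : t = 1 by lra.
  by rewrite mul0r add0r mul1r.
have Vpow p r : 0 <= p -> (p^-1) `^ r = (p `^ r)^-1 :> R.
  by move=> p0; rewrite -(powR_inv1 p0) -powRrM mulN1r powRN.
have Pa := P0 _ a0; have Pb := P0 _ b0.
rewrite !termE !powRM ?invr_ge0 ?(ltW W0) ?(ltW Pa) ?(ltW Pb)//.
rewrite mulrACA -powRD; last by rewrite st oner_eq0.
rewrite st powRr1 ?(ltW W0)// ler_pM2l// !Vpow ?(ltW Pa) ?(ltW Pb)// -invfM.
rewrite lef_pV2 ?posrE ?mulr_gt0 ?powR_gt0 ?P0//.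
have -> : q `^ (s * a + t * b) = (q `^ a) `^ s * (q `^ b) `^ t.
  by rewrite -!powRrM -powRD ?(mulrC a) ?(mulrC b)// (gt_eqF q0) implybT.
exact: qpochhammer_log_concave (c01 _ a0) (c01 _ b0).
Qed.

Lemma phi_term_cvg q x mu : 0 < q < 1 -> 0 < x < 1 -> 0 < mu ->
  cvgn (series (phi_term q x mu)).
Proof. by move=> q01 x01 mu0; apply: is_cvg_heine_ge0 => //; exact: powR_in01. Qed.

Lemma series_phi_term_le q x mu n : 0 < q < 1 -> 0 < x < 1 -> 0 < mu ->
  series (phi_term q x mu) n <= phi q mu x.
Proof.
move=> q01 x01 mu0; rewrite phiE.
apply: (@nondecreasing_cvgn_le _ (series (phi_term q x mu))).
  apply: ger0_nondecreasing_series => m.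
  by case/andP: x01 => ? _; rewrite ltW// phi_term_gt0.
exact: phi_term_cvg.
Qed.

Lemma phi_gt0 (q x mu : R) : 0 < q < 1 -> 0 < x < 1 -> 0 < mu -> 0 < phi q mu x.
Proof.
move=> q01 x01 mu0; apply: lt_le_trans (series_phi_term_le _ _ _ 1 q01 x01 mu0).
rewrite /series/= big_nat1 phi_term_gt0//; by case/andP: x01.
Qed.

Lemma phi_log_convex (q x a b s t : R) : 0 < q < 1 -> 0 < x < 1 ->
  0 < a -> 0 < b -> 0 <= s -> 0 <= t -> s + t = 1 -> 0 < s * a + t * b ->
  phi q (s * a + t * b) x <= phi q a x `^ s * phi q b x `^ t.
Proof.
move=> q01 x01 a0 b0 s0 t0 st c0; have x0 : 0 < x by case/andP: x01.
have Fa := phi_gt0 _ _ _ q01 x01 a0; have Fb := phi_gt0 _ _ _ q01 x01 b0.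
rewrite [phi q (_ + _) x]phiE.
apply: limr_le; first exact: phi_term_cvg.
near=> n.
have F0 : 0 < phi q a x `^ s * phi q b x `^ t by rewrite mulr_gt0 ?powR_gt0.
rewrite -[leRHS]mulr1 -ler_pdivrMl//.
(* As in Hoelder's inequality, the terms are normalised by the full sums: each ratio is at most 1,
   and the weights add up to 1. *)
apply: (@le_trans _ _ (s * (series (phi_term q x a) n / phi q a x) +
                       t * (series (phi_term q x b) n / phi q b x))); last first.
  have ratio_le1 c : 0 < c -> series (phi_term q x c) n / phi q c x <= 1.
    move=> c_gt0; rewrite ler_pdivrMr ?mul1r; first exact: series_phi_term_le.
    exact: phi_gt0.
  by rewrite -st; apply: lerD; apply: ler_piMr => //; exact: ratio_le1.
rewrite /series/= !mulr_suml !mulr_sumr -big_split/=; apply: ler_sum => k _.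
have Ta := phi_term_gt0 q x a k q01 a0 x0.
have Tb := phi_term_gt0 q x b k q01 b0 x0.
rewrite ler_pdivrMl; last exact: F0.
apply: le_trans (weighted_amgm_scale _ _ _ _ _ _ s0 t0 st Ta Tb Fa Fb).
exact: phi_term_log_convex.
Unshelve. all: by end_near. Qed.

End LogConvexity.

(** * The endpoint [mu = 0], products of Heine series, and the theorem *)

Lemma ephi_gt0 (R : realType) (q x mu : R) : 0 < q < 1 -> 0 < x < 1 ->
  0 <= mu -> (0 < ephi q mu x)%E.
Proof.
move=> q01 x01; have /andP[x0 x1] := x01.
rewrite le_eqVlt => /predU1P[<-|mu0]; first by rewrite ephi0// ltry.
by rewrite ephiE ?(ltW x0)// lte_fin phi_gt0.
Qed.

(** The coefficients are nonnegative, so absolute convergence at [x] is convergence at [|x|]. *)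
Lemma phi_cauchy_product (R : realType) (q a b x : R) :
  0 < q < 1 -> 0 < a -> 0 < b -> `|x| < 1 ->
  pseries (cauchy_product _ (heine_coef 0 0 (q `^ a) q)
                            (heine_coef 0 0 (q `^ b) q)) x @ \oo -->
    phi q a x * phi q b x.
Proof.
move=> q01 a0 b0 x1.
have nc c : 0 < c ->
    cvgn [normed series (fun n => heine_coef 0 0 (q `^ c) q n * x ^+ n)].
  move=> c0; have := @is_cvg_heine _ _ _ `|x| q01 (powR_in01 q01 c0).
  rewrite normr_id => /(_ x1); rewrite (_ : pseries _ _ = [normed series
    (fun n => heine_coef 0 0 (q `^ c) q n * x ^+ n)])//; congr (series _).
  apply/funext => n; rewrite /= normrM normrX ger0_norm//.
  have q01' : 0 <= q < 1 by case/andP: q01 => ? ->; rewrite ltW.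
  rewrite /heine_coef !qpochhammer0l mulr1 divr_ge0// mulr_ge0// ltW//.
    by rewrite qpochhammer_gt0// powR_in01.
  by rewrite qpochhammer_gt0.
have := series_cauchy_product_cvg _ _ _ (nc _ a0) (nc _ b0).
rewrite (_ : series _ = pseries (cauchy_product _ (heine_coef 0 0 (q `^ a) q)
  (heine_coef 0 0 (q `^ b) q)) x)//; congr (series _); apply/funext => n.
rewrite /cauchy_product /= mulr_suml; apply: eq_bigr => k _.
by rewrite mulrACA -exprD subnKC// -ltnS.
Qed.

Theorem theorem2 (R : realType) (q : R) (hq : 0 < q < 1) :
  (forall mu alpha beta : R, 0 < mu -> 0 < alpha -> 0 < beta ->
     exists c : nat -> R,
       [/\ has_power_series c 1 (turanian (phi q) mu alpha beta),
           c 0%N = 0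
         & forall n : nat, (0 < n)%N -> c n < 0])
  /\
  (forall x : R, 0 < x < 1 ->
     log_convex_on [set mu : R | 0 <= mu] (fun mu => ephi q mu x)).
Proof.
have q0 : 0 < q by case/andP: hq.
split.
  move=> mu alpha beta mu0 a0 b0; pose h m := heine_coef 0 0 (q `^ m) q.
  exists (fun n => cauchy_product _ (h (mu + alpha)) (h (mu + beta)) n
         - cauchy_product _ (h mu) (h (mu + alpha + beta)) n); split.
  - move=> x x1; rewrite /turanian.
    have c1 := phi_cauchy_product _ _ _ _ _ hq (addr_gt0 mu0 a0) (addr_gt0 mu0 b0) x1.
    have c2 := phi_cauchy_product _ _ _ _ _ hq mu0
      (addr_gt0 (addr_gt0 mu0 a0) b0) x1.
    rewrite (_ : pseries _ x = fun n =>
      pseries (cauchy_product _ (h (mu + alpha)) (h (mu + beta))) x n -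
      pseries (cauchy_product _ (h mu) (h (mu + alpha + beta))) x n).
      exact: (cvgB c1 c2).
    apply/funext => n; rewrite /pseries /series/= -sumrB.
    by apply: eq_bigr => k _; rewrite mulrBl.
  (* Both products have constant coefficient 1, so negativity starts at [n = 1]. *)
  - by rewrite /cauchy_product !big_ord1 /h /heine_coef /qpochhammer !big_ord0
      !mulr1 invr1 !mulr1 subrr.
  - move=> n n0; rewrite subr_lt0 /h !powRD ?(gt_eqF q0) ?implybT//.
    have p01 m : 0 < m -> 0 < q `^ m < 1.
      by move=> m0; rewrite powR_gt0//=; case/andP: (powR_in01 hq m0).
    by apply: cauchy_product_heine_lt => //; exact: p01.
move=> x x01; have /andP[x0 x1] := x01.
split=> [a|a b t]/=; first exact: ephi_gt0.
move=> a0 b0 /andP[t0 t1].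
(* Excluding -oo ensures that adding this term to +oo gives +oo. *)
have lneNy r c : 0 < r -> 0 <= c -> (r%:E * lne (ephi q c x) != -oo)%E.
  move=> r0 c0; have := ephi_gt0 _ _ _ _ hq x01 c0.
  by case: (ephi q c x) => [y| |]// y0; rewrite ?lne_EFin//= gt0_muley ?lte_fin.
(* For [t] equal to 0 or 1 the convention 0 * +oo = 0 removes one term, and the two sides agree. *)
have [->|t00] := eqVneq t 0.
  by rewrite !mul0r !mul0e add0r add0e subr0 mul1r mul1e.
have [->|t11] := eqVneq t 1.
  by rewrite subrr !mul0r !mul0e addr0 adde0 mul1r mul1e.
have {t00}t0 : 0 < t by rewrite lt_neqAle eq_sym t00.
have {t11}t1 : 0 < 1 - t by rewrite subr_gt0 lt_neqAle t11.
(* Both weights are now positive, so an endpoint at 0 makes the right-hand side +oo. *)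
move: a0; rewrite le_eqVlt => /predU1P[<-|a0].
  by rewrite ephi0//= gt0_muley ?lte_fin// addye ?leey// lneNy.
move: b0; rewrite le_eqVlt => /predU1P[<-|b0].
  by rewrite ephi0//= gt0_muley ?lte_fin// addey ?leey// lneNy// ltW.
have c0 : 0 < t * a + (1 - t) * b by rewrite addr_gt0 ?mulr_gt0.
have Fa := phi_gt0 _ _ _ _ hq x01 a0; have Fb := phi_gt0 _ _ _ _ hq x01 b0.
have Fc := phi_gt0 _ _ _ _ hq x01 c0.
rewrite !ephiE ?(ltW x0)// !lne_EFin// -!EFinM -EFinD lee_fin.
rewrite -!ln_powR -lnM ?posrE ?powR_gt0// ler_ln ?posrE ?mulr_gt0 ?powR_gt0//.
by apply: phi_log_convex; rewrite ?(ltW t0) ?(ltW t1) ?subrKC.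
Qed.
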